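(* Let $\langle T,\trianglelefteq\rangle$ be a finite crown-free poset. Then the lattice $\mathbf{Co}(T)$ satisfies the quasi-identity $(\theta)$.
   Context: For a poset $\langle T,\trianglelefteq\rangle$, a subset $X\subseteq T$ is order-convex if $x\trianglelefteq z\trianglelefteq y$ and $x,y\in X$ imply $z\in X$, for all $x,y,z\in T$. $\mathbf{Co}(T)$ denotes the lattice of all order-convex subsets of $T$, ordered by inclusion. For an integer $n\geq2$, the $n$-crown $C_n$ is the poset with underlying set $(\mathbb{Z}/n\mathbb{Z})\times\{0,1\}$ whose only strict order relations are $(i,0)<(i,1)$ and $(i+1,0)<(i,1)$, for $i\in\mathbb{Z}/n\mathbb{Z}$. An $n$-crown of a poset $T$ is a family $\langle\langle a_i,b_i\rangle\mid i\in\mathbb{Z}/n\mathbb{Z}\rangle$ of elements of $T\times T$ such that there is an order-embedding $f\colon C_n\hookrightarrow T$ with $f(i,0)=a_i$ and $f(i,1)=b_i$ for all $i$. A poset is crown-free if it has no $n$-crown for any $n\geq3$. $(\theta)$ is the following lattice quasi-identity in the variables $a,b,c,a',b',c'$: if $$a\leq(a'\vee b)\wedge(a'\vee c),\qquad b\leq(b'\vee a)\wedge(b'\vee c),\qquad c\leq(c'\vee a)\wedge(c'\vee b),$$ and $$(a'\wedge a)\vee(b'\wedge b)\vee(c'\wedge c)\vee(a\wedge b)\vee(a\wedge c)\vee(b\wedge c)\leq a'\wedge b'\wedge c',$$ then $a\leq a'$. *)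

(* Defs.v *)
From HB Require Import structures.
From mathcomp Require Import all_boot all_order all_algebra.

Set Implicit Arguments.
Unset Strict Implicit.
Unset Printing Implicit Defensive.

Import Order.TTheory.
Local Open Scope order_scope.

Definition order_convex d (T : finPOrderType d) (X : {set T}) : bool :=
  [forall x, forall y, forall z,
     [&& x \in X, y \in X, x <= z & z <= y] ==> (z \in X)].

Lemma order_convexP d (T : finPOrderType d) (X : {set T}) :
  reflect (forall x y z : T, x <= z -> z <= y -> x \in X -> y \in X -> z \in X)
          (order_convex X).
Proof.
apply: (iffP forallP) => [cX x y z xz zy xX yX | cX x].
  move/(_ x)/forallP/(_ y)/forallP/(_ z)/implyP: cX; apply.
  by rewrite xX yX xz zy.
apply/forallP => y; apply/forallP => z; apply/implyP => /and4P[xX yX xz zy].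
exact: cX xz zy xX yX.
Qed.

Record Co d (T : finPOrderType d) : Type :=
  MkCo { Co_set :> {set T}; Co_convex : order_convex Co_set }.

HB.instance Definition _ d (T : finPOrderType d) := [isSub for @Co_set d T].
HB.instance Definition _ d (T : finPOrderType d) := [Finite of Co T by <:].

Fact Co_display : Order.disp_t. Proof. exact: Order.Disp tt tt. Qed.

Section CoLattice.
Context d (T : finPOrderType d).
Implicit Types A B C : Co T.

Definition Co_le A B : bool := Co_set A \subset Co_set B.

Fact Co_le_refl : reflexive Co_le. Proof. by move=> A; apply: subxx. Qed.

Fact Co_le_anti : antisymmetric Co_le.
Proof. by move=> A B AB; apply: val_inj; apply/eqP; rewrite eqEsubset. Qed.

Fact Co_le_trans : transitive Co_le.
Proof. by move=> B A C; apply: subset_trans. Qed.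

HB.instance Definition _ :=
  Order.Le_isPOrder.Build Co_display (Co T) Co_le_refl Co_le_anti Co_le_trans.

Fact Co_meet_convex A B : order_convex (Co_set A :&: Co_set B).
Proof.
apply/order_convexP => x y z xz zy; rewrite !inE => /andP[xA xB] /andP[yA yB].
by rewrite (order_convexP _ (Co_convex A) x y) //
           (order_convexP _ (Co_convex B) x y).
Qed.

Definition Co_meet A B : Co T := MkCo (Co_meet_convex A B).

Definition convex_hull (X : {set T}) : {set T} :=
  [set z | [exists x in X, exists y in X, (x <= z) && (z <= y)]].

Fact convex_hull_convex X : order_convex (convex_hull X).
Proof.
apply/order_convexP => x y z xz zy; rewrite !inE.
case/exists_inP => u uX /exists_inP[_ _ /andP[ux _]].
case/exists_inP => _ _ /exists_inP[v vX /andP[_ yv]].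
apply/exists_inP; exists u => //; apply/exists_inP; exists v => //.
by rewrite (le_trans ux xz) (le_trans zy yv).
Qed.

Definition Co_join A B : Co T :=
  MkCo (convex_hull_convex (Co_set A :|: Co_set B)).

Fact Co_meetP A B C : (A <= Co_meet B C) = (A <= B) && (A <= C).
Proof. exact: subsetI. Qed.

Fact Co_joinP A B C : (Co_join A B <= C) = (A <= C) && (B <= C).
Proof.
rewrite /Order.le /= /Co_le /= -subUset; apply/subsetP/subsetP => sub z zAB.
  apply: sub; rewrite inE; apply/exists_inP; exists z => //.
  by apply/exists_inP; exists z; rewrite ?lexx.
move: zAB; rewrite inE => /exists_inP[x xAB /exists_inP[y yAB /andP[xz zy]]].
exact: (order_convexP _ (Co_convex C)) xz zy (sub _ xAB) (sub _ yAB).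
Qed.

HB.instance Definition _ :=
  Order.POrder_MeetJoin_isLattice.Build Co_display (Co T) Co_meetP Co_joinP.

End CoLattice.

(* The crown with 2n elements; [(i, false)] and [(i, true)] stand for (i,0) and
   (i,1).  ['Z_n] is Z/nZ for n >= 2 only, so [crown n] is meaningful only for
   n >= 2. *)
Definition crown (n : nat) : Type := ('Z_n * bool)%type.

HB.instance Definition _ n := Finite.copy (crown n) ('Z_n * bool)%type.

Fact crown_display : Order.disp_t. Proof. exact: Order.Disp tt tt. Qed.

Section CrownOrder.
Variable n : nat.
Implicit Types x y z : crown n.

Definition crown_lt x y : bool :=
  [&& ~~ x.2, y.2 & (x.1 == y.1) || (x.1 == (y.1 + 1)%R)].

Definition crown_le x y : bool := (x == y) || crown_lt x y.

Fact crown_lt_def x y : crown_lt x y = (y != x) && crown_le x y.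
Proof.
rewrite /crown_le eq_sym; case: eqP => [->|] //=.
by rewrite /crown_lt; case: (y.2).
Qed.

Fact crown_le_refl : reflexive crown_le.
Proof. by move=> x; rewrite /crown_le eqxx. Qed.

Fact crown_le_anti : antisymmetric crown_le.
Proof.
move=> x y /andP[/orP[/eqP-> //|/and3P[_ y1 _]]].
by case/orP => [/eqP-> //|/and3P[/negP]].
Qed.

Fact crown_le_trans : transitive crown_le.
Proof.
move=> y x z /orP[/eqP-> //|/[dup] xy /and3P[_ y1 _]].
case/orP => [/eqP<-|/and3P[/negP//]].
by rewrite /crown_le xy orbT.
Qed.

HB.instance Definition _ :=
  Order.isPOrder.Build crown_display (crown n)
    crown_lt_def crown_le_refl crown_le_anti crown_le_trans.

End CrownOrder.

Definition order_embedding d1 d2 (S : porderType d1) (T : porderType d2)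
  (f : S -> T) : Prop := {mono f : x y / x <= y}.

Definition is_crown d (T : porderType d) (n : nat) (ab : 'Z_n -> T * T) : Prop :=
  exists f : crown n -> T,
    order_embedding f /\
    forall i : 'Z_n, f (i, false) = (ab i).1 /\ f (i, true) = (ab i).2.

Definition crown_free d (T : porderType d) : Prop :=
  forall n : nat, (3 <= n)%N -> ~ exists ab : 'Z_n -> T * T, is_crown ab.

Definition satisfies_theta d (L : latticeType d) : Prop :=
  forall a b c a' b' c' : L,
    a <= (a' `|` b) `&` (a' `|` c) ->
    b <= (b' `|` a) `&` (b' `|` c) ->
    c <= (c' `|` a) `&` (c' `|` b) ->
    (a' `&` a) `|` (b' `&` b) `|` (c' `&` c)
      `|` (a `&` b) `|` (a `&` c) `|` (b `&` c) <= a' `&` b' `&` c' ->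
    a <= a'.

(* Main.v *)
Require Import Defs.
From mathcomp Require Import all_boot all_order all_algebra.
From mathcomp Require Import zify.

(** Call a point of [a \ a'], [b \ b'] or [c \ c'] low if it lies above a point
    of the corresponding primed set, and high if it lies below one.  The
    premises of (theta) say that every point of [a \ a'] is low or high, that
    every low point of one colour lies below high points of the two other
    colours, and dually, and that a low point is never below a high point of
    its own colour.  Following the colours cyclically yields closed walks
    through the comparability graph, alternating between low and high points.
    A chord of a closed walk joins points of distinct colours, so in one of its
    two orientations it respects the cyclic order of the colours and cuts off a
    shorter closed walk of the same kind.  A shortest one is therefore chordless;
    its length is a positive multiple of 6, so it is an [n]-crown with
    [n >= 3]. *)

Set Implicit Arguments.
Unset Strict Implicit.
Unset Printing Implicit Defensive.

Import Order.TTheory GRing.Theory.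
Local Open Scope order_scope.

(** * Comparisons uniform in the two sides *)

Section Direction.
Context d (T : finPOrderType d).
Implicit Types (b : bool) (x y z : T) (A B : Co T).

(* Sides are booleans, [false] for low and [true] for high; [dir b] compares in
   the direction leading from side [b] to the opposite one. *)
Definition dir b x y := if b then y <= x else x <= y.

Lemma dirN b x y : dir (~~ b) x y = dir b y x.
Proof. by case: b. Qed.

Lemma dir_trans b y x z : dir b x y -> dir b y z -> dir b x z.
Proof. by case: b => /= xy yz; [apply: le_trans yz xy | apply: le_trans xy yz]. Qed.

Lemma Co_dir b A x y z :
  dir b x z -> dir b z y -> x \in Co_set A -> y \in Co_set A -> z \in Co_set A.
Proof.
case: b => /= xz zy xA yA.
  exact: (order_convexP _ (Co_convex A)) zy xz yA xA.
exact: (order_convexP _ (Co_convex A)) xz zy xA yA.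
Qed.

Lemma in_Co_join b A B z : z \in Co_set (A `|` B) ->
  exists x y, [/\ x \in Co_set A :|: Co_set B, y \in Co_set A :|: Co_set B,
                  dir b x z & dir b z y].
Proof.
rewrite inE => /exists_inP[x xAB /exists_inP[y yAB /andP[xz zy]]].
by case: b; [exists y, x | exists x, y].
Qed.

End Direction.

(** * Walks through coloured points *)

Section ColouredWalks.
Context d (T : finPOrderType d) (P : bool -> 'Z_3 -> pred T).
Hypothesis P_nbr : forall b i j x, P b i x -> j != i ->
  exists2 y, P (~~ b) j y & dir b x y.
Hypothesis P_sep : forall b i x y, P b i x -> P (~~ b) i y -> ~~ dir b x y.

(** For a third colour [k], neighbours [u] of [y] and [z] of [x] of colour [k] would give a chain
    [u], [y], [x], [z] in direction [b], against [P_sep]. *)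
Lemma opposite_side_dir b i j x y :
  P b i x -> P (~~ b) j y -> ~~ dir b y x.
Proof.
move=> Px Py; apply/negP => yx.
have [k /andP[ki kj]] : exists k : 'Z_3, (k != i) && (k != j).
  apply/existsP; move: i j {Px Py} => [[|[|[|//]]] ?] [[|[|[|//]]] ?];
  apply/existsP;
  by [exists (inZp 0) | exists (inZp 1) | exists (inZp 2)].
have [z Pz xz] := P_nbr Px ki.
have [u Pu yu] := P_nbr Py kj.
rewrite negbK dirN in Pu yu.
by move/negP: (P_sep Pu Pz); apply; apply: dir_trans yu (dir_trans yx xz).
Qed.

(* The state [(x, b, i)] is the point [x] on side [b] with colour [i]. *)
Definition edge (v w : T * bool * 'Z_3) :=
  [&& P v.1.2 v.2 v.1.1, P w.1.2 w.2 w.1.1, dir v.1.2 v.1.1 w.1.1,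
      w.1.2 == ~~ v.1.2 & w.2 == (v.2 + 1)%R].

(** By [P_sep] the colours differ, and of two distinct residues modulo 3 one is the successor of the
    other. *)
Lemma edge_opposite b i j x y : P b i x -> P (~~ b) j y -> dir b x y ->
  edge (x, b, i) (y, ~~ b, j) || edge (y, ~~ b, j) (x, b, i).
Proof.
move=> Px Py xy; rewrite /edge /= Px Py xy dirN xy negbK !eqxx /=.
have: i != j by apply: contraTneq xy => ij; rewrite (P_sep Px) ?ij.
by move: i j {Px Py} => [[|[|[|//]]] ?] [[|[|[|//]]] ?].
Qed.

Definition walk (f : nat -> T * bool * 'Z_3) := forall k, edge (f k) (f k.+1).

Lemma walk_colour f k : walk f ->
  (f k).1.2 = odd k (+) (f 0).1.2 /\ (f k).2 = ((f 0).2 + k%:R)%R.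
Proof.
move=> wf; elim: k => [|k [IHb IHc]]; first by rewrite addr0.
have /and5P[_ _ _ /eqP-> /eqP->] := wf k.
by rewrite IHb IHc addNb -addrA natr1.
Qed.

Lemma walk_periodic f i l : walk f -> edge (f (i + l)) (f i) ->
  walk (fun k => f (i + k %% l.+1)).
Proof.
move=> wf fil k; have := ltn_pmod k (ltn0Sn l); rewrite ltnS leq_eqVlt.
have ->: k.+1 %% l.+1 = (k %% l.+1).+1 %% l.+1 by rewrite -addn1 -modnDml addn1.
case/predU1P => [->|lt_kl]; first by rewrite modnn addn0.
by rewrite [(k %% l.+1).+1 %% _]modn_small ?ltnS // addnS.
Qed.

(** * A chordless closed walk is a crown *)

Section ChordlessWalk.
Variables (m : nat) (f : nat -> T * bool * 'Z_3).
Hypothesis m_gt0 : (0 < m)%N.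
Hypothesis f_walk : walk f.
Hypothesis f_low : (f 0).1.2 = false.
Hypothesis f_per : forall k, f (k + m) = f k.
Hypothesis f_chordless : forall i l, edge (f (i + l)) (f i) -> (m <= l.+1)%N.

Let f_mod k : f (k %% m) = f k.
Proof.
rewrite [in RHS](divn_eq k m) addnC; elim: (k %/ m) => [|q IH].
  by rewrite addn0.
by rewrite mulSn addnCA addnC f_per.
Qed.

(** The edge closes up the stretch of walk from [j] forward to [i]; this cycle cannot be shorter
    than [m], so [j] comes right after [i]. *)
Lemma edge_mod i j : edge (f i) (f j) -> j = i.+1 %[mod m].
Proof.
rewrite -(f_mod i) -(f_mod j) -addn1 -(modnDml i) addn1.
have := ltn_pmod i m_gt0; have := ltn_pmod j m_gt0.
move: (i %% m) (j %% m) (modn_mod j m) => {}i {}j' jm jlt ilt.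
case: (leqP j' i) => [le_ji|lt_ij] fij.
  have := @f_chordless j' (i - j'); rewrite subnKC // => /(_ fij) le_m.
  have -> : i.+1 = m by lia.
  by rewrite modnn; lia.
have := @f_chordless j' (i + m - j'); rewrite subnKC; last by lia.
rewrite f_per => /(_ fij) le_m.
by have -> : i.+1 = j' by lia.
Qed.

(** Alternating sides make [m] even; colours advancing by one make it divisible by 3. *)
Lemma walk_length : exists n, m = n.+2.*2 /\ (3 <= n.+2)%N.
Proof.
have [] := walk_colour m f_walk.
rewrite -[m in (f m).1.2]add0n -[m in (f m).2]add0n !f_per f_low addbF.
move=> odd_m; rewrite -[X in X = _]addr0 => /addrI/esym/(congr1 val).
rewrite /= val_Zp_nat //= => m3.
by exists (m./2 - 2)%N; split; lia.
Qed.

Lemma walk_crown : exists n, (3 <= n)%N /\ exists ab : 'Z_n -> T * T, is_crown ab.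
Proof.
have [n [m2 n3]] := walk_length; exists n.+2; split=> //.
pose x k := (f k).1.1; pose c k := ((f 0).2 + k%:R)%R : 'Z_3.
have Px k : P (odd k) (c k) (x k).
  have /andP[+ _] := f_walk k.
  by have [-> ->] := walk_colour k f_walk; rewrite f_low addbF.
have fE k : f k = (x k, odd k, c k).
  have [] := walk_colour k f_walk; rewrite f_low addbF /x /c.
  by case: (f k) => [[? ?] ?] /= -> ->.
have xS k : dir (odd k) (x k) (x k.+1).
  have /and3P[_ _ /andP[+ _]] := f_walk k.
  by have [-> _] := walk_colour k f_walk; rewrite f_low addbF.
have x_mod k : x (k %% m) = x k by rewrite /x f_mod.
have low_le_high (i j : 'Z_n.+2) :
    x (i.*2) <= x (j.*2.+1) -> (i == j) || (i == (j + 1)%R).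
  move=> le_ij; have := Px i.*2; have := Px j.*2.+1.
  rewrite /= !odd_double /= => Pj Pi.
  have := edge_opposite Pi Pj le_ij.
  have [Ei Ej] := (fE i.*2, fE j.*2.+1).
  rewrite /= !odd_double /= in Ei Ej; rewrite -Ei -Ej.
  have lti : (i < n.+2)%N := ltn_ord i.
  have ltj : (j < n.+2)%N := ltn_ord j.
  (* An edge leaving the low point gives [i = j], one leaving the high point [i = j + 1]. *)
  case/orP => /edge_mod /eqP; rewrite m2.
    rewrite !modn_small; try lia.
    by move=> ij; apply/orP; left; apply/eqP/val_inj => /=; lia.
  rewrite -doubleS -!muln2 -!muln_modl eqn_pmul2r // modn_small // => /eqP ij.
  by apply/orP; right; apply/eqP/val_inj; rewrite /= ij addn1.
have low_next (i : 'Z_n.+2) : x ((i + 1)%R : 'Z_n.+2).*2 <= x i.*2.+1.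
  have := xS i.*2.+1; rewrite /= odd_double /= -doubleS -x_mod.
  by rewrite m2 -!muln2 -muln_modl -[i.+1]addn1.
have low_high (i : 'Z_n.+2) : x i.*2 <= x i.*2.+1.
  by have := xS i.*2; rewrite /= odd_double.
have Plow (i : 'Z_n.+2) : P false (c i.*2) (x i.*2).
  by have := Px i.*2; rewrite odd_double.
have Phigh (i : 'Z_n.+2) : P true (c i.*2.+1) (x i.*2.+1).
  by have := Px i.*2.+1; rewrite /= odd_double.
have shift2 (i : 'Z_n.+2) : (i == i + 1 + 1)%R = false.
  rewrite -addrA -[eqbLHS]addr0 (inj_eq (addrI _)).
  by rewrite -val_eqE /= !modn_small.
pose h (p : crown n.+2) := x (if p.2 then p.1.*2.+1 else p.1.*2).
exists (fun i => (x i.*2, x i.*2.+1)), h; split => // -[i b] [j b'].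
rewrite [RHS]/Order.le /= /crown_le /crown_lt xpair_eqE /h /=.
case: b b' => [] [] /=; rewrite ?andbT ?andbF ?orbF ?orFb.
(* Low points [i] and [i + 1] both lie below high point [i], hence below high point [j]; as 2 is
   nonzero modulo [n.+2], this forces [i = j]. *)
- apply/idP/eqP => [le_ij|->]; last exact: lexx.
  have := low_le_high _ _ (le_trans (low_high i) le_ij).
  have := low_le_high _ _ (le_trans (low_next i) le_ij).
  rewrite (inj_eq (addIr _)) => /orP[/eqP<-|/eqP-> //].
  by rewrite shift2 orbF => /eqP.
- by apply/negbTE/(opposite_side_dir (b := false) (Plow j) (Phigh i)).
- apply/idP/orP => [/low_le_high/orP //|[/eqP->|/eqP->]]; [exact: low_high|exact: low_next].
(* Dually, with high points [j] and [j - 1] above low point [j]. *)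
apply/idP/eqP => [le_ij|->]; last exact: lexx.
have := low_le_high _ _ (le_trans le_ij (low_high j)).
have := low_next (j - 1)%R; rewrite subrK => /(le_trans le_ij)/low_le_high.
rewrite subrK => /orP[/eqP-> | /eqP-> //].
by rewrite [X in _ || X]subr_eq shift2 orbF => /eqP.
Qed.

End ChordlessWalk.

(** * Walks in crown-free posets *)

Hypothesis T_crown_free : crown_free T.

(** Strong induction on [l]: the induction hypothesis makes the closed walk, repeated periodically,
    chordless. *)
Lemma walk_no_back_edge l f i : walk f -> ~~ edge (f (i + l)) (f i).
Proof.
move=> wf; apply/negP => fil.
elim/ltn_ind: l => l IH in f i wf fil *.
have wg := walk_periodic wf fil.
set g := (fun k => _) in wg.
(* As a number, [s] is 1 exactly when [g] starts high, so the shifted walk starts low. *)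
pose s : nat := (g 0).1.2.
have wgs : walk (fun k => g (k + s)) by move=> k; apply: wg.
have gs0 : (g (0 + s)).1.2 = false.
  by have [-> _] := walk_colour (0 + s) wg; rewrite oddb addbb.
have gs_per k : g (k + l.+1 + s) = g (k + s) by rewrite /g addnAC modnDr.
have gs_chordless i' l' : edge (g (i' + l' + s)) (g (i' + s)) -> (l.+1 <= l'.+1)%N.
  rewrite ltnS leqNgt => e; apply/negP => lt_l'l.
  exact: IH _ lt_l'l (fun k => g (k + s)) i' wgs e.
have [n [n3 ab]] := walk_crown (ltn0Sn l) wgs gs0 gs_per gs_chordless.
exact: T_crown_free n3 ab.
Qed.

(** Among finitely many states one recurs, and the step into its second occurrence is a back
    edge. *)
Lemma crown_free_no_walk f : ~ walk f.
Proof.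
move=> wf; pose N := #|{: T * bool * 'Z_3}|.
have /injectivePn[i [j neq_ij fij]] : ~~ injectiveb (fun i : 'I_N.+1 => f i).
  by apply/injectiveP => /leq_card; rewrite card_ord ltnn.
wlog lt_ij : i j neq_ij fij / (i < j)%N.
  by move: (neq_ij); rewrite -val_eqE neq_ltn => /orP[] lt_ij IH;
     [apply: (IH i j) | apply: (IH j i)] => //; rewrite eq_sym.
have := walk_no_back_edge (j.-1 - i) i wf; rewrite subnKC; last by lia.
by have := wf j.-1; rewrite prednK ?(leq_ltn_trans _ lt_ij) // -fij => ->.
Qed.

Lemma crown_free_empty b i x : ~~ P b i x.
Proof.
apply/negP => Px.
(* The default [v] is returned only at states outside [P]: elsewhere [P_nbr] supplies an edge. *)
pose next v := odflt v [pick w | edge v w].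
have nextP v : P v.1.2 v.2 v.1.1 -> edge v (next v).
  rewrite /next; case: pickP => //= no_edge Pv.
  have [|y Py vy] := P_nbr (j := (v.2 + 1)%R) Pv.
    by rewrite -subr_eq0 addrAC subrr add0r.
  by have := no_edge (y, ~~ v.1.2, (v.2 + 1)%R); rewrite /edge /= Pv Py vy !eqxx.
apply: (@crown_free_no_walk (fun k => iter k next (x, b, i))) => k /=.
apply: (nextP); elim: k => //= k /nextP /and3P[_ + _]; exact.
Qed.

End ColouredWalks.

(** * The premises of the quasi-identity as a colouring *)

Section Theta.
Context d (T : finPOrderType d) (s s' : 'Z_3 -> Co T).
Hypothesis s_join : forall i j, j != i -> s i <= s' i `|` s j.
Hypothesis s_meet : forall i j, s i `&` s' i <= s' j.
Hypothesis s_disj : forall i j k, i != j -> s i `&` s j <= s' k.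

(** The low points of colour [i] for [b = false], the high ones for [b = true]. *)
Definition exposed b i x :=
  [&& x \in Co_set (s i), x \notin Co_set (s' i) &
      [exists p in Co_set (s' i), dir b p x]].

Let s_disjP i j k x : i != j -> x \in Co_set (s i) -> x \in Co_set (s j) ->
  x \in Co_set (s' k).
Proof.
by move=> ij xi xj; apply: (subsetP (s_disj k ij)); rewrite inE xi xj.
Qed.

(** If both hull witnesses were in [s' i], so would be [x]; if neither, both are in [s j], so [x] is
    in [s i] and [s j], hence again in [s' i]. *)
Lemma exposed_witness b i j x : j != i ->
  x \in Co_set (s i) -> x \notin Co_set (s' i) ->
  exists p q, [/\ p \in Co_set (s' i) :|: Co_set (s j),
    q \in Co_set (s' i) :|: Co_set (s j), dir b p x, dir b x q &
    (p \in Co_set (s' i)) != (q \in Co_set (s' i))].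
Proof.
move=> ji xs xs'.
have [p [q [pU qU px xq]]] := in_Co_join b (subsetP (s_join ji) _ xs).
exists p, q; split=> //; apply: contraNN xs' => /eqP pq.
have [ps'|pNs'] := boolP (p \in Co_set (s' i)).
  by apply: (Co_dir px xq ps'); rewrite -pq.
have qNs' : q \notin Co_set (s' i) by rewrite -pq.
rewrite !inE (negPf pNs') (negPf qNs') /= in pU qU.
exact: s_disjP ji (Co_dir px xq pU qU) xs.
Qed.

Lemma exposed_nbr b i j x : exposed b i x -> j != i ->
  exists2 y, exposed (~~ b) j y & dir b x y.
Proof.
case/and3P => xs xs' /exists_inP[p ps' px] ji.
have [_ [y [_ yU _ xy _]]] := exposed_witness b ji xs xs'.
have yNs' : y \notin Co_set (s' i).
  by apply: contraNN xs' => ys'; apply: Co_dir px xy ps' ys'.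
move: yU; rewrite inE (negPf yNs') /= => ys.
have yNs'j : y \notin Co_set (s' j).
  apply: contraNN yNs' => ys'.
  by apply: (subsetP (s_meet j i)); rewrite inE ys ys'.
exists y => //; rewrite /exposed ys yNs'j /=.
have ij : i != j by rewrite eq_sym.
(* The witness [q] lies in [s' j]: were it in [s i], then [y], between [x] and [q], would be in both
   [s i] and [s j], hence in [s' i]. *)
have [_ [q [_ qU _ yq _]]] := exposed_witness b ij ys yNs'j.
apply/exists_inP; exists q; last by rewrite dirN.
move: qU; rewrite inE => /orP[//|qs].
by case/negP: yNs'; apply: s_disjP ij (Co_dir xy yq xs qs) ys.
Qed.

Lemma exposed_sep b i x y :
  exposed b i x -> exposed (~~ b) i y -> ~~ dir b x y.
Proof.
case/and3P => _ xs' /exists_inP[p ps' px] /and3P[_ _ /exists_inP[q qs']].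
rewrite dirN => yq; apply: contraNN xs' => xy.
exact: Co_dir px (dir_trans xy yq) ps' qs'.
Qed.

Lemma crown_free_theta i : crown_free T -> s i <= s' i.
Proof.
move=> cfT; apply/subsetP => x xs; apply: contraT => xs'.
have ji : (i + 1 != i)%R by rewrite -subr_eq0 addrAC subrr add0r.
have [p [q [_ _ px xq pq]]] := exposed_witness false ji xs xs'.
have no b := crown_free_empty exposed_nbr exposed_sep cfT b i x.
have [ps'|pNs'] := boolP (p \in Co_set (s' i)).
  have := no false; rewrite /exposed xs xs' /=.
  by move=> /exists_inP[]; exists p.
have := no true; rewrite /exposed xs xs' /= => /exists_inP[]; exists q => //.
by move: pq; rewrite (negPf pNs'); case: (q \in _).
Qed.

End Theta.

Theorem theorem10p1 (d : Order.disp_t) (T : finPOrderType d) :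
  crown_free T -> satisfies_theta (Co T).
Proof.
move=> cfT a b c a' b' c'; rewrite !lexI !leUx.
move=> /andP[ab ac] /andP[ba bc] /andP[ca cb] meets.
apply: (@crown_free_theta _ T (nth a [:: a; b; c]) (nth a' [:: a'; b'; c'])
          _ _ _ 0%R cfT);
  repeat match goal with H : is_true (_ && _) |- _ => case/andP: H => ? ? end.
- by move=> [[|[|[|//]]] ?] [[|[|[|//]]] ?].
- by move=> [[|[|[|//]]] ?] [[|[|[|//]]] ?] /=; rewrite meetC.
by move=> [[|[|[|//]]] ?] [[|[|[|//]]] ?] [[|[|[|//]]] ?] //= _; rewrite meetC.
Qed.
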